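(* Let $s\ge 1$ be an integer, $\mu>0$, $0\le \underline{\lambda}<\overline{\lambda}<s\mu$, $m\in(\underline{\lambda},\overline{\lambda})$ and $\sigma>0$ with $\sigma^2\in\big(0,(\overline{\lambda}-m)(m-\underline{\lambda})\big)$. Consider an M/M/$s$ queue with service rate $\mu$ per server and random arrival rate $\Lambda$ whose distribution $\mathbb{P}$ belongs to the ambiguity set $\mathcal{P}(m,\sigma,\underline{\lambda},\overline{\lambda})$. Then the tight upper bound for the expected waiting time, $\max_{\mathbb{P}\in\mathcal{P}(m,\sigma,\underline{\lambda},\overline{\lambda})}\mathbb{E}_{\mathbb{P}}[W(s,\Lambda)]$, is attained by the two-point distribution with support $$\lambda_1=m-\frac{\sigma^2}{\overline{\lambda}-m},\qquad \lambda_2=\overline{\lambda},$$ and corresponding probabilities $$p_1=\frac{(\overline{\lambda}-m)^2}{(\overline{\lambda}-m)^2+\sigma^2},\qquad p_2=\frac{\sigma^2}{(\overline{\lambda}-m)^2+\sigma^2}.$$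
   Context: $\mathcal{P}(m,\sigma,\underline{\lambda},\overline{\lambda})$ is the set of all probability distributions $\mathbb{P}$ supported in $[\underline{\lambda},\overline{\lambda}]$ with $\mathbb{E}_{\mathbb{P}}[\Lambda]=m$ and $\mathbb{E}_{\mathbb{P}}[\Lambda^2]=\sigma^2+m^2$. $W(s,\lambda)$ denotes the stationary expected waiting time (including time in service) in the M/M/$s$ queue with Poisson arrivals of rate $\lambda$, $s$ parallel servers each with service rate $\mu$, and $\lambda<s\mu$. Explicitly, with $\rho=\lambda/(s\mu)$, $$W(s,\lambda)=\frac{L(s,\lambda)}{\lambda},\quad L(s,\lambda)=s\rho+\frac{\rho}{1-\rho}C(s,\lambda),\quad\text{i.e. } W(s,\lambda)=\frac1\mu+\frac{C(s,\lambda)}{s\mu-\lambda},$$ where $C(s,\lambda)$ is the Erlang-C delay probability $$C(s,\lambda)=\frac{\frac{(\lambda/\mu)^s}{s!}\frac{1}{1-\rho}}{\sum_{k=0}^{s-1}\frac{(\lambda/\mu)^k}{k!}+\frac{(\lambda/\mu)^s}{s!}\frac{1}{1-\rho}};$$ at $\lambda=0$, $W(s,0)=1/\mu$. A ''tight upper bound attained by $\mathbb{P}^*$'' means that $\mathbb{P}^*$ belongs to the ambiguity set and maximizes the expectation over it. *)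

(* Defs.v *)
From HB Require Import structures.
From mathcomp Require Import all_boot all_order all_algebra.
From mathcomp Require Import all_classical all_reals all_analysis.
From mathcomp Require Import ring.

Set Implicit Arguments.
Unset Strict Implicit.
Unset Printing Implicit Defensive.
Import Order.TTheory GRing.Theory Num.Theory.
Import numFieldNormedType.Exports.

Local Open Scope classical_set_scope.
Local Open Scope ring_scope.

Section MMs.
Context {R : realType}.
Implicit Types (s : nat) (mu lambda : R).

Definition utilization s mu lambda : R := lambda / (s%:R * mu).

(* The unnormalized stationary probability that all [s] servers are busy. *)
Definition erlang_tail s mu lambda : R :=
  (lambda / mu) ^+ s / s`!%:R * (1 - utilization s mu lambda)^-1.

Definition erlang_C s mu lambda : R :=
  erlang_tail s mu lambda /
  (\sum_(k < s) (lambda / mu) ^+ k / k`!%:R + erlang_tail s mu lambda).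

Definition mean_number s mu lambda : R :=
  let rho := utilization s mu lambda in
  s%:R * rho + rho / (1 - rho) * erlang_C s mu lambda.

(* Little's law [L / lambda], with the value [1 / mu] at [lambda = 0], where
   the quotient is [0 / 0].  Meaningful for [0 <= lambda < s * mu] only. *)
Definition waiting_time s mu lambda : R :=
  if lambda == 0 then mu^-1 else mean_number s mu lambda / lambda.

Lemma waiting_timeE s mu lambda :
  (0 < s)%N -> 0 < mu -> 0 <= lambda -> lambda < s%:R * mu ->
  waiting_time s mu lambda =
    mu^-1 + erlang_C s mu lambda / (s%:R * mu - lambda).
Proof.
move=> s0 mu0 l0 ls; rewrite /waiting_time; case: eqVneq => [->|ln0].
  by rewrite /erlang_C /erlang_tail mul0r expr0n eqn0Ngt s0/= !mul0r addr0.
have sn0 : s%:R != 0 :> R by rewrite pnatr_eq0 -lt0n.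
have mun0 : mu != 0 by rewrite gt_eqF.
have dn0 : s%:R * mu - lambda != 0 by rewrite subr_eq0 gt_eqF.
rewrite /mean_number /utilization; set C := erlang_C _ _ _.
by field; rewrite sn0 mun0 ln0 dn0.
Qed.

End MMs.

Section ambiguity.
Context {R : realType}.

(* The law of the random arrival rate is a probability [P] on the line, and
   the arrival rate is the identity random variable under [P]. *)
Definition ambiguity_set (m sigma lmin lmax : R) :
    set (probability (measurableTypeR R) R) :=
  [set P : probability (measurableTypeR R) R |
    [/\ P `[lmin, lmax]%classic = 1%E,
        ('E_P[fun x : R => x] = m%:E)%E &
        ('E_P[fun x : R => (x ^+ 2)%R] = (sigma ^+ 2 + m ^+ 2)%:E)%E]].

Definition is_two_point (P : probability (measurableTypeR R) R)
    (x1 x2 : measurableTypeR R) (p1 p2 : R) : Prop :=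
  forall A, measurable A -> P A = (p1%:E * \d_x1 A + p2%:E * \d_x2 A)%E.

Definition attains_max (S : set (probability (measurableTypeR R) R))
    (f : R -> R) (Pstar : probability (measurableTypeR R) R) : Prop :=
  S Pstar /\ forall P, S P -> ('E_P[f] <= 'E_Pstar[f])%E.

End ambiguity.

(* Main.v *)
(* After scaling [a = lambda / mu], the waiting time is [(1 + f a) / mu] with
   [f = C / u], [u = s - a], and it suffices that [f''' >= 0] on [0 < a < s]:
   then the quadratic that is tangent to [W] at [lambda_1] and meets it at
   [lmax] lies above [W] on [0 <= lambda <= lmax] (Rolle, applied three times),
   and the expectation of a quadratic is constant on the ambiguity set.

   For the sign of [f'''], write [1 / C = 1 + u E] where
   [E = \int_0^oo exp (- a t) (1 + t) ^+ (s - 1) dt].  The equation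
   [E' = - (1 + u E) / a] gives [f' = f g] with [g = 2 / u - f + s / a - 1], so
   that [u ^+ 3 * f''' / f] is a polynomial in [C], [y = u ^+ 2 / a] and
   [w = u / a].  Induction on [s] shows [1 + u E <= a E ^+ 2], that is
   [y C <= (1 - C) ^+ 2]; together with [w <= y / 2 + 1], valid for [s >= 2],
   this makes the polynomial nonnegative.  For [s = 1], [f = a / (1 - a)]. *)

From HB Require Import structures.
Require Import Defs.
From mathcomp Require Import all_boot all_order all_algebra.
From mathcomp Require Import all_classical all_reals all_analysis.
From mathcomp Require Import measurable_realfun ring lra.
Set Implicit Arguments.
Unset Strict Implicit.
Unset Printing Implicit Defensive.
Import Order.TTheory GRing.Theory Num.Theory.
Import numFieldNormedType.Exports.
Local Open Scope classical_set_scope.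
Local Open Scope ring_scope.

(** * The Erlang integral *)

Section ErlangIntegral.
Context {R : realType}.
Implicit Types (n : nat) (a : R).

(* [\int_0^oo exp (- a t) (1 + t) ^+ n dt], through integration by parts. *)
Fixpoint erlang_int n a : R :=
  if n is n'.+1 then (1 + n%:R * erlang_int n' a) / a else a^-1.

Lemma erlang_int_gt0 n a : 0 < a -> 0 < erlang_int n a.
Proof.
move=> a0; elim: n => [|n IH] /=; first by rewrite invr_gt0.
by rewrite divr_gt0// addr_gt0// mulr_gt0.
Qed.

Lemma erlang_intE n a : a != 0 ->
  \sum_(k < n.+1) a ^+ k / k`!%:R = erlang_int n a * a ^+ n.+1 / n`!%:R.
Proof.
move=> a0; elim: n => [|n IH].
  by rewrite big_ord1 expr0 fact0 expr1 /= mulVf.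
rewrite big_ord_recr /= IH factS natrM.
have n0 : n.+1%:R != 0 :> R by rewrite pnatr_eq0.
have f0 : n`!%:R != 0 :> R by rewrite pnatr_eq0 -lt0n fact_gt0.
rewrite [a ^+ n.+2]exprS.
by field; rewrite nat1r n0 f0 a0.
Qed.

(** In integral form this quantity is - a E', that is a times the integral of exp (- a t) t (1 +
    t)^n. No bound [a < n.+1%:R] is assumed: the induction in [erlang_int_sqr_ge] keeps [a] fixed
    and goes through small [n]. *)
Lemma erlang_int_gtV n a : 0 < a -> 0 < 1 + (n.+1%:R - a) * erlang_int n a.
Proof.
move=> a0; have an0 : a != 0 by rewrite gt_eqF.
elim: n => [|n IH] /=.
  by rewrite mulrBl mul1r mulfV// addrC subrK invr_gt0.
have -> : 1 + (n.+2%:R - a) * ((1 + n.+1%:R * erlang_int n a) / a) =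
    (n.+1%:R * (1 + (n.+1%:R - a) * erlang_int n a)
      + 1 + n.+1%:R * erlang_int n a) / a.
  by rewrite -[n.+2]addn1 natrD; field.
rewrite divr_gt0// addr_gt0// ?mulr_gt0 ?erlang_int_gt0//.
by rewrite addr_gt0// mulr_gt0.
Qed.

(** Equality holds at [n = 0]. From [n] to [n.+1] the defect, right minus left, becomes N / a times
    the old defect plus E (1 + (N - a) E), and the latter is positive by [erlang_int_gtV]. *)
Lemma erlang_int_sqr_ge n a : 0 < a ->
  1 + (n.+1%:R - a) * erlang_int n a <= a * erlang_int n a ^+ 2.
Proof.
move=> a0; have an0 : a != 0 by rewrite gt_eqF.
elim: n => [|n IH] /=.
  have -> : 1 + (1 - a) / a = a^-1 by field.
  by have -> : a * a^-1 ^+ 2 = a^-1 by field.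
have := erlang_int_gtV n a0; have := erlang_int_gt0 n a0.
set E := erlang_int n a in IH *; set N : R := n.+1%:R in IH * => E0 V0.
have N0 : 0 < N by rewrite ltr0n.
have -> : n.+2%:R = N + 1 by rewrite /N -addn1 natrD.
rewrite -subr_ge0.
have -> : a * ((1 + N * E) / a) ^+ 2 - (1 + (N + 1 - a) * ((1 + N * E) / a)) =
    N * ((a * E ^+ 2 - (1 + (N - a) * E)) + E * (1 + (N - a) * E)) / a.
  by field.
apply: divr_ge0; last exact: ltW.
apply: mulr_ge0; first exact: ltW.
by apply: addr_ge0; rewrite ?subr_ge0// mulr_ge0// ltW.
Qed.

(** Differentiating under the integral brings down - t = 1 - (1 + t), so E_n' = E_n - E_{n+1}, and
    the recurrence eliminates E_{n+1}. The proof replaces this by induction on [n]. *)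
Lemma is_derive_erlang_int n a : 0 < a ->
  is_derive a 1 (erlang_int n)
    (- (1 + (n.+1%:R - a) * erlang_int n a) / a).
Proof.
move=> a0; have an0 : a != 0 by rewrite gt_eqF.
elim: n => [|n IH].
  have -> : erlang_int 0 = (fun y : R => (id y)^-1) by [].
  apply: is_derive_eq; first exact: is_deriveV.
  by rewrite /= /GRing.scale /=; field.
have dV : is_derive a 1 (fun y : R => (id y)^-1) _ :=
  is_deriveV (f := id) an0 (is_derive_id _ _).
have dE : is_derive a 1
    ((cst 1 + cst n.+1%:R * erlang_int n) * (fun y : R => (id y)^-1)) _ :=
  is_deriveM (is_deriveD (is_derive_cst _ _ _)
    (is_deriveM (is_derive_cst _ _ _) IH)) dV.
have -> : erlang_int n.+1 =
    (cst 1 + cst n.+1%:R * erlang_int n) * (fun y : R => (id y)^-1).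
  by apply/funext.
apply: is_derive_eq.
rewrite /= /GRing.scale /= !fctE /cst -[in RHS](addn1 n.+1) natrD.
by field.
Qed.

End ErlangIntegral.

(** * The third derivative of the scaled delay *)

Section ThirdDerivative.
Context {R : realType}.
Implicit Types (n : nat) (a : R).

(** The function f = C / u for [n.+1] servers at load [a]. *)
Definition scaled_delay n a : R :=
  ((n.+1%:R - a) * (1 + (n.+1%:R - a) * erlang_int n a))^-1.

Definition logderiv n a : R :=
  2 / (n.+1%:R - a) - scaled_delay n a + n.+1%:R / a - 1.

(** This is g'; it and g'' stay algebraic because f' = f g is substituted wherever f is
    differentiated. *)
Definition logderiv1 n a : R :=
  2 / (n.+1%:R - a) ^+ 2 - scaled_delay n a * logderiv n a
  - n.+1%:R / a ^+ 2.

Definition logderiv2 n a : R :=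
  4 / (n.+1%:R - a) ^+ 3
  - scaled_delay n a * (logderiv n a ^+ 2 + logderiv1 n a)
  + 2 * n.+1%:R / a ^+ 3.

Lemma scaled_delay_den_neq0 n a : 0 < a < n.+1%:R ->
  1 + (n.+1%:R - a) * erlang_int n a != 0.
Proof. by move=> /andP[a0 _]; rewrite gt_eqF// erlang_int_gtV. Qed.

(** With V = 1 + u E, the logarithmic derivative of 1 / (u V) is 1 / u - V' / V. Here V' = - E - u V
    / a, while E / V = 1 / u - f and u / a = s / a - 1. *)
Lemma is_derive_scaled_delay n a : 0 < a < n.+1%:R ->
  is_derive a 1 (scaled_delay n) (scaled_delay n a * logderiv n a).
Proof.
move=> an; have /andP[a0 an1] := an.
have an0 : a != 0 by rewrite gt_eqF.
have un0 : n.+1%:R - a != 0 by rewrite subr_eq0 gt_eqF.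
have vn0 := scaled_delay_den_neq0 an.
have dE := is_derive_erlang_int n a0.
pose u : R -> R := cst n.+1%:R - id.
have du : is_derive a 1 u _ :=
  is_deriveB (is_derive_cst _ _ _) (is_derive_id _ _).
have dden : is_derive a 1 (u * (cst 1 + u * erlang_int n)) _ :=
  is_deriveM du (is_deriveD (is_derive_cst _ _ _) (is_deriveM du dE)).
have dV : is_derive a 1 (fun y => ((u * (cst 1 + u * erlang_int n)) y)^-1) _ :=
  is_deriveV (f := u * (cst 1 + u * erlang_int n)) (mulf_neq0 un0 vn0) dden.
have -> : scaled_delay n = (fun y => ((u * (cst 1 + u * erlang_int n)) y)^-1).
  by apply/funext.
apply: is_derive_eq.
rewrite /u.
rewrite /= /GRing.scale /= !fctE /logderiv /scaled_delay /cst.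
by field; rewrite nat1r an0 un0 vn0.
Qed.

Lemma is_derive_logderiv n a : 0 < a < n.+1%:R ->
  is_derive a 1 (logderiv n) (logderiv1 n a).
Proof.
move=> an; have /andP[a0 an1] := an.
have an0 : a != 0 by rewrite gt_eqF.
have un0 : n.+1%:R - a != 0 by rewrite subr_eq0 gt_eqF.
have df := is_derive_scaled_delay an.
have dV : is_derive a 1 (fun y : R => (id y)^-1) _ :=
  is_deriveV (f := id) an0 (is_derive_id _ _).
pose u : R -> R := cst n.+1%:R - id.
have du : is_derive a 1 u _ :=
  is_deriveB (is_derive_cst _ _ _) (is_derive_id _ _).
have dU : is_derive a 1 (fun y : R => (u y)^-1) _ := is_deriveV (f := u) un0 du.
have dg : is_derive a 1 (cst 2 * (fun y => (u y)^-1)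
   - scaled_delay n + cst n.+1%:R * (fun y => (id y)^-1) - cst 1) _ :=
  is_deriveB (is_deriveD (is_deriveB (is_deriveM (is_derive_cst _ _ _) dU) df)
    (is_deriveM (is_derive_cst _ _ _) dV)) (is_derive_cst _ _ _).
have -> : logderiv n = cst 2 * (fun y => (u y)^-1)
   - scaled_delay n + cst n.+1%:R * (fun y => (id y)^-1) - cst 1.
  by apply/funext.
apply: is_derive_eq.
rewrite /u /= /GRing.scale /= !fctE /cst /logderiv1.
by field; rewrite nat1r an0 un0.
Qed.

Lemma is_derive_logderiv1 n a : 0 < a < n.+1%:R ->
  is_derive a 1 (logderiv1 n) (logderiv2 n a).
Proof.
move=> an; have /andP[a0 an1] := an.
have an0 : a != 0 by rewrite gt_eqF.
have un0 : n.+1%:R - a != 0 by rewrite subr_eq0 gt_eqF.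
have df := is_derive_scaled_delay an.
have dg := is_derive_logderiv an.
have dV : is_derive a 1 (fun y : R => ((id ^+ 2 : R -> R) y)^-1) _ :=
  is_deriveV (f := id ^+ 2) (expf_neq0 2 an0) (is_deriveX 2 (is_derive_id _ _)).
pose u : R -> R := cst n.+1%:R - id.
have du : is_derive a 1 u _ :=
  is_deriveB (is_derive_cst _ _ _) (is_derive_id _ _).
have dU : is_derive a 1 (fun y : R => ((u ^+ 2) y)^-1) _ :=
  is_deriveV (f := u ^+ 2) (expf_neq0 2 un0) (is_deriveX 2 du).
have -> : logderiv1 n =
   cst 2 * (fun y => ((u ^+ 2) y)^-1) - scaled_delay n * logderiv n
   - cst n.+1%:R * (fun y => ((id ^+ 2 : R -> R) y)^-1).
  by apply/funext.
apply: is_derive_eq.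
rewrite /u /= /GRing.scale /= !fctE /cst /logderiv2.
by field; rewrite nat1r an0 un0.
Qed.

Definition scaled_delay1 n a : R := scaled_delay n a * logderiv n a.

Definition scaled_delay2 n a : R :=
  scaled_delay n a * (logderiv n a ^+ 2 + logderiv1 n a).

Definition scaled_delay3 n a : R :=
  scaled_delay n a *
  (logderiv n a ^+ 3 + 3 * logderiv n a * logderiv1 n a + logderiv2 n a).

Lemma is_derive_scaled_delay1 n a : 0 < a < n.+1%:R ->
  is_derive a 1 (scaled_delay1 n) (scaled_delay2 n a).
Proof.
move=> an.
have df := is_derive_scaled_delay an.
have dg := is_derive_logderiv an.
have -> : scaled_delay1 n = scaled_delay n * logderiv n by apply/funext.
apply: is_derive_eq.
by rewrite /GRing.scale /= /scaled_delay2; ring.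
Qed.

Lemma is_derive_scaled_delay2 n a : 0 < a < n.+1%:R ->
  is_derive a 1 (scaled_delay2 n) (scaled_delay3 n a).
Proof.
move=> an.
have df := is_derive_scaled_delay an.
have dg := is_derive_logderiv an.
have dg1 := is_derive_logderiv1 an.
have -> : scaled_delay2 n = scaled_delay n * (logderiv n ^+ 2 + logderiv1 n).
  by apply/funext.
apply: is_derive_eq.
by rewrite /GRing.scale /= !fctE /scaled_delay3; ring.
Qed.

Lemma third_derivative_poly_ge0 (C y w : R) : 0 < C -> C <= 1 -> 0 <= y ->
  y * C <= (1 - C) ^+ 2 -> w <= y / 2 + 1 ->
  0 <= (2 + y) ^+ 3 - 7 * (2 + y) ^+ 2 * C + 12 * (2 + y) * C ^+ 2
    - 6 * C ^+ 3 + (6 + 3 * y - 4 * C) * (2 - y - y * w)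
    + 4 + 2 * y * w + 2 * y * w ^+ 2.
Proof.
move=> C0 C1 y0 yC wy.
(* In terms of the slack [d], the polynomial splits into the four nonnegative pieces [p1] to [p4],
   the first one taken five times. *)
set d := y / 2 + 1 - w.
have d0 : 0 <= d by rewrite subr_ge0.
have -> : w = y / 2 + 1 - d by rewrite /d; ring.
have p1 : 0 <= (2 + y) * ((1 - C) ^+ 2 - y * C).
  by rewrite mulr_ge0 ?subr_ge0// addr_ge0.
have p2 : 0 <= y * (5 + 5 * C ^+ 2).
  by rewrite mulr_ge0// addr_ge0// mulr_ge0// sqr_ge0.
have p3 : 0 <= y * (2 * (d - C) ^+ 2 + y * d).
  by rewrite mulr_ge0// addr_ge0// mulr_ge0// sqr_ge0.
(* Replacing C^3 by C^2 leaves 8 (C - 1)^2 + 6. *)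
have p4 : 0 <= 14 + 14 * C ^+ 2 - 16 * C - 6 * C ^+ 3.
  have C2 : C ^+ 3 <= C ^+ 2 by rewrite exprSr ler_piMr// sqr_ge0.
  have := sqr_ge0 (C - 1); lra.
rewrite [leRHS](_ : _ = 5 * ((2 + y) * ((1 - C) ^+ 2 - y * C))
  + y * (2 * (d - C) ^+ 2 + y * d) + y * (5 + 5 * C ^+ 2)
  + (14 + 14 * C ^+ 2 - 16 * C - 6 * C ^+ 3)); last by field.
apply: addr_ge0 p4; apply: addr_ge0 p2; apply: addr_ge0 p3.
exact: mulr_ge0.
Qed.

(** Writing s = u + a gives u g = 2 + y - C, and likewise u^2 g' and u^3 g'' become polynomials in
    C, y and w. *)
Lemma scaled_delay3E n a : 0 < a < n.+1%:R ->
  let u := n.+1%:R - a in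
  let C := (1 + u * erlang_int n a)^-1 in
  let y := u ^+ 2 / a in let w := u / a in
  scaled_delay3 n a = C / u ^+ 4 *
    ((2 + y) ^+ 3 - 7 * (2 + y) ^+ 2 * C + 12 * (2 + y) * C ^+ 2
    - 6 * C ^+ 3 + (6 + 3 * y - 4 * C) * (2 - y - y * w)
    + 4 + 2 * y * w + 2 * y * w ^+ 2).
Proof.
move=> an u C y w; have /andP[a0 an1] := an.
have an0 : a != 0 by rewrite gt_eqF.
have un0 : u != 0 by rewrite subr_eq0 gt_eqF.
have fE : scaled_delay n a = C / u by rewrite /scaled_delay invfM mulrC.
rewrite /scaled_delay3 /logderiv2 /logderiv1 /logderiv fE -/u /y /w.
have -> : n.+1%:R = u + a by rewrite subrK.
move: u C un0 {y w fE} => u C un0.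
by field; rewrite an0 un0.
Qed.

Lemma scaled_delay3_ge0 n a : 0 < a < n.+1%:R -> 0 <= scaled_delay3 n a.
Proof.
move=> an; have /andP[a0 an1] := an.
have an0 : a != 0 by rewrite gt_eqF.
have u0 : 0 < n.+1%:R - a by rewrite subr_gt0.
rewrite scaled_delay3E//; move: u0; set u := n.+1%:R - a => u0.
have un0 : u != 0 by rewrite gt_eqF.
have E0 := erlang_int_gt0 n a0.
have v0 : 0 < 1 + u * erlang_int n a := erlang_int_gtV n a0.
(* For one server w <= y / 2 + 1 can fail, but then C = a, f = 1 / u - 1, and the third derivative
   is 6 / u^4. *)
case: n {an} an1 @u u0 un0 E0 v0 => [|n] an1 u u0 un0 E0 v0.
  have ua : u = 1 - a by [].
  rewrite /= in v0 *.
  have -> : (1 + u * a^-1)^-1 = a.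
    by rewrite ua mulrBl mul1r mulfV// addrC subrK invrK.
  rewrite [leRHS](_ : _ = 6 / u ^+ 4); first by rewrite divr_ge0// exprn_ge0 ?ltW.
  have -> : a = 1 - u by rewrite ua subKr.
  by field; rewrite un0 ua subKr.
apply: mulr_ge0; first by rewrite divr_ge0 ?invr_ge0 ?exprn_ge0 ?ltW.
apply: third_derivative_poly_ge0.
- by rewrite invr_gt0.
- by rewrite invf_le1// lerDl mulr_ge0 ?ltW.
- by rewrite divr_ge0 ?sqr_ge0 ?ltW.
- rewrite -subr_ge0.
  have := erlang_int_sqr_ge n.+1 a0; rewrite -/u.
  move: (erlang_int n.+1 a) v0 E0 => E v0 E0 hE.
  rewrite [leRHS](_ : _ = u ^+ 2 / (a * (1 + u * E) ^+ 2) *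
    (a * E ^+ 2 - (1 + u * E))); last by field; rewrite an0 gt_eqF.
  rewrite mulr_ge0 ?subr_ge0//.
  by rewrite divr_ge0 ?sqr_ge0 ?mulr_ge0 ?sqr_ge0 ?ltW.
(* Since u + a = s >= 2, the numerator is at least (u - 2)^2 / 2. *)
- rewrite -subr_ge0 [leRHS](_ : _ = (u ^+ 2 / 2 + a - u) / a); last by field.
  apply: divr_ge0; last exact: ltW.
  have : 2 <= u + a by rewrite subrK (ler_nat _ 2).
  have : 0 <= (u - 2) ^+ 2 by exact: sqr_ge0.
  clearbody u; lra.
Qed.

End ThirdDerivative.

(** * Quadratic Hermite interpolation *)

Section Rolle.
Context {R : realType}.
Implicit Types (F : R -> R) (a b x : R).

Lemma Rolle_is_derive F F1 (lo hi a b : R) :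
  (forall x, lo < x < hi -> is_derive x 1 F (F1 x)) ->
  lo < a -> a < b -> b < hi -> F a = F b ->
  exists c, [/\ a < c, c < b & F1 c = 0].
Proof.
move=> dF la ab bh Fab.
have dF' x : a <= x <= b -> is_derive x 1 F (F1 x).
  by move=> /andP[ax xb]; apply: dF; rewrite (lt_le_trans la ax) (le_lt_trans xb bh).
have [||c] := @Rolle R F a b ab _ _ Fab.
- move=> x; rewrite in_itv /= => /andP[ax xb].
  by have [] : is_derive x 1 F (F1 x) by apply: dF'; rewrite !ltW.
- apply: derivable_within_continuous => x; rewrite in_itv /= => axb.
  by have [] := dF' x axb.
move=> cab dc; exists c; move: cab; rewrite in_itv /= => /andP[ac cb].
split => //.
have dFc : is_derive c 1 F (F1 c) by apply: dF'; rewrite !ltW.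
by rewrite -(@derive_val _ _ _ _ _ _ _ dFc) (@derive_val _ _ _ _ _ _ _ dc).
Qed.

(** [F] is meant as a function minus its interpolating quadratic. The Hermite error formula F x = F3
    c / 6 (x - x1)^2 (x - x2) has the sign of x - x2. *)
Lemma le_hermite_quadratic F F1 F2 F3 (lo hi x1 x2 : R) :
  (forall x, lo < x < hi -> is_derive x 1 F (F1 x)) ->
  (forall x, lo < x < hi -> is_derive x 1 F1 (F2 x)) ->
  (forall x, lo < x < hi -> is_derive x 1 F2 (F3 x)) ->
  (forall x, lo < x < hi -> 0 <= F3 x) ->
  lo < x1 -> x1 < x2 -> x2 < hi ->
  F x1 = 0 -> F1 x1 = 0 -> F x2 = 0 ->
  forall x, lo < x -> x <= x2 -> F x <= 0.
Proof.
move=> dF dF1 dF2 F30 lx1 x12 x2h Fx1 F1x1 Fx2 x lx.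
rewrite le_eqVlt => /predU1P[->|xx2]; first by rewrite Fx2.
have [->|xx1] := eqVneq x x1; first by rewrite Fx1.
pose p : {poly R} := ('X - x1%:P) ^+ 2 * ('X - x2%:P).
have px : p.[x] < 0.
  rewrite /p !hornerE pmulr_rlt0 ?subr_lt0//.
  by rewrite exprn_even_gt0//= subr_eq0.
(* With this [k], [G] vanishes at [x] as well as at [x2] and doubly at [x1]. As [p] is a monic
   cubic, a zero of G''' gives 6 k = F3 c. *)
pose k := F x / p.[x].
pose q := k *: p.
pose G := F \- horner q.
pose G1 := F1 \- horner (deriv q).
pose G2 := F2 \- horner (deriv (deriv q)).
pose G3 := F3 \- horner (deriv (deriv (deriv q))).
have dG t : lo < t < hi -> is_derive t 1 G (G1 t).
  by move=> /dF dFt; apply: is_deriveB.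
have dG1 t : lo < t < hi -> is_derive t 1 G1 (G2 t).
  by move=> /dF1 dFt; apply: is_deriveB.
have dG2 t : lo < t < hi -> is_derive t 1 G2 (G3 t).
  by move=> /dF2 dFt; apply: is_deriveB.
have G3E t : G3 t = F3 t - k * 6.
  by rewrite /G3 /= /q /p !poly.derivE !hornerE /=; ring.
have G10 : G1 x1 = 0.
  by rewrite /G1 /= F1x1 /q /p !poly.derivE !hornerE /=; ring.
have Gx1 : G x1 = 0.
  by rewrite /G /= Fx1 /q /p !hornerE /= subrr mulr0 mul0r oppr0.
have Gx2 : G x2 = 0 by rewrite /G /= Fx2 /q /p !hornerE /= subrr mulr0 oppr0.
have Gx : G x = 0 by rewrite /G /= /q hornerZ divfK ?subrr// lt_eqF.
suff [c cI F3c] : exists2 c, lo < c < hi & G3 c = 0.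
  have k0 : 0 <= k.
    have := F30 _ cI; move: F3c; rewrite G3E => /eqP; rewrite subr_eq0 => /eqP ->.
    by rewrite pmulr_lge0.
  by rewrite -[F x](divfK (negbT (lt_eqF px))) nmulr_lle0.
(* G' vanishes at [x1] and at a Rolle point in each of the two gaps between [x], [x1], [x2]; three
   zeros of G' give two of G''. The cases are the two orders of [x] and [x1]. *)
have [a [b [la ab bh G1a G1b]]] : exists a b,
    [/\ lo < a, a < b, b < hi, G2 a = 0 & G2 b = 0].
  have [x1x|xltx1] := ltP x1 x.
    have [c [x1c cx G1c]] := Rolle_is_derive dG lx1 x1x (lt_trans xx2 x2h)
      (etrans Gx1 (esym Gx)).
    have [d [xd dx2 G1d]] := Rolle_is_derive dG lx xx2 x2h
      (etrans Gx (esym Gx2)).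
    have cd := lt_trans cx xd; have dh := lt_trans dx2 x2h.
    have lc := lt_trans lx1 x1c.
    have [e [x1e ec G2e]] := Rolle_is_derive dG1 lx1 x1c (lt_trans cd dh)
      (etrans G10 (esym G1c)).
    have [f [cf fd G2f]] := Rolle_is_derive dG1 lc cd dh
      (etrans G1c (esym G1d)).
    exists e, f; split => //.
    - exact: lt_trans lx1 x1e.
    - exact: lt_trans ec cf.
    - exact: lt_trans fd dh.
  have {}xx1 : x < x1 by rewrite lt_neqAle xx1.
  have x1h := lt_trans x12 x2h.
  have [c [xc cx1 G1c]] := Rolle_is_derive dG lx xx1 x1h
      (etrans Gx (esym Gx1)).
  have [d [x1d dx2 G1d]] := Rolle_is_derive dG lx1 x12 x2h
      (etrans Gx1 (esym Gx2)).
  have dh := lt_trans dx2 x2h.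
  have lc := lt_trans lx xc.
  have [e [ce ex1 G2e]] := Rolle_is_derive dG1 lc cx1 x1h
      (etrans G1c (esym G10)).
  have [f [x1f fd G2f]] := Rolle_is_derive dG1 lx1 x1d dh
      (etrans G10 (esym G1d)).
  exists e, f; split => //.
  - exact: lt_trans lc ce.
  - exact: lt_trans ex1 x1f.
  - exact: lt_trans fd dh.
have [c [ac cb G3c]] := Rolle_is_derive dG2 la ab bh
      (etrans G1a (esym G1b)).
by exists c => //; rewrite (lt_trans la ac) (lt_trans cb bh).
Qed.
End Rolle.

(** * A quadratic majorant of the waiting time *)

Section Waiting.
Context {R : realType}.
Implicit Types (n s : nat) (mu x : R).

Lemma erlang_C_erlang_int n mu x : 0 < mu -> 0 < x < n.+1%:R * mu ->
  erlang_C n.+1 mu x =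
    (1 + (n.+1%:R - x / mu) * erlang_int n (x / mu))^-1.
Proof.
move=> mu0 /andP[x0 xs].
have mun0 : mu != 0 by rewrite gt_eqF.
have a0 : 0 < x / mu by rewrite divr_gt0.
have as1 : x / mu < n.+1%:R by rewrite ltr_pdivrMr.
rewrite /erlang_C /erlang_tail /utilization erlang_intE ?gt_eqF//.
have -> : x / (n.+1%:R * mu) = x / mu / n.+1%:R by rewrite invfM mulrA mulrAC.
move: (x / mu) a0 as1 => a a0 as1.
have an0 : a ^+ n.+1 != 0 by rewrite expf_neq0// gt_eqF.
have un0 : n.+1%:R - a != 0 by rewrite subr_eq0 gt_eqF.
have n0 : n.+1%:R != 0 :> R by rewrite pnatr_eq0.
have f0 : n`!%:R != 0 :> R by rewrite pnatr_eq0 -lt0n fact_gt0.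
have v0 := scaled_delay_den_neq0 (introT andP (conj a0 as1)).
rewrite factS natrM.
move: (a ^+ n.+1) (erlang_int n a) an0 v0 => b E bn0 v0.
move: (n.+1%:R : R) (n`!%:R : R) n0 f0 un0 v0 {as1} => N f n0 f0 un0 v0.
have -> : 1 - a / N = (N - a) / N by rewrite mulrBl divff.
rewrite invf_div.
(* The factor pulled out is the tail itself, so it cancels in the quotient and leaves the inverse of
   1 + u E. *)
have -> : E * b / f + b / (N * f) * (N / (N - a)) =
    b / (f * (N - a)) * (1 + (N - a) * E) by field; rewrite n0 f0 un0.
by field; rewrite n0 f0 un0 bn0 v0.
Qed.

(** At [x = 0], division by zero makes [erlang_int] equal to 0 and [scaled_delay] equal to 1 / s,
    whereas C is 0 there; that point is always treated apart. *)
Lemma waiting_time_scaled_delay n mu x : 0 < mu -> 0 < x < n.+1%:R * mu ->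
  waiting_time n.+1 mu x = mu^-1 * (1 + scaled_delay n (x / mu)).
Proof.
move=> mu0 xI; have /andP[x0 xs] := xI.
have mun0 : mu != 0 by rewrite gt_eqF.
rewrite waiting_timeE ?(ltW x0)// erlang_C_erlang_int// /scaled_delay.
have -> : n.+1%:R * mu - x = mu * (n.+1%:R - x / mu).
  by field.
by rewrite [RHS]mulrDr [mu^-1 * 1]mulr1 !invfM; congr (_ + _);
  rewrite mulrCA [X in _ * X]mulrC.
Qed.

Lemma scaled_delay_ge0 n (a : R) : 0 < a < n.+1%:R -> 0 <= scaled_delay n a.
Proof.
move=> /andP[a0 an]; rewrite invr_ge0 mulr_ge0// ?subr_ge0 ltW//.
exact: erlang_int_gtV.
Qed.

Lemma waiting_time_ge0 s mu x : (0 < s)%N -> 0 < mu ->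
  0 <= x < s%:R * mu -> 0 <= waiting_time s mu x.
Proof.
case: s => // n _ mu0 /andP[]; rewrite le_eqVlt => /predU1P[<-|x0] xs.
  by rewrite /waiting_time eqxx invr_ge0 ltW.
rewrite waiting_time_scaled_delay ?x0// mulr_ge0 ?invr_ge0 ?(ltW mu0)//.
by rewrite addr_ge0// scaled_delay_ge0// divr_gt0//= ltr_pdivrMr.
Qed.

Lemma waiting_time_le_quadratic s mu x1 x2 : (0 < s)%N -> 0 < mu ->
  0 < x1 -> x1 < x2 -> x2 < s%:R * mu ->
  exists c0 c1 c2 : R, let q x := c0 + c1 * x + c2 * x ^+ 2 in
  [/\ forall x, 0 <= x <= x2 -> waiting_time s mu x <= q x,
      waiting_time s mu x1 = q x1 & waiting_time s mu x2 = q x2].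
Proof.
case: s => // n _ mu0 x10 x12 x2s.
have mun0 : mu != 0 by rewrite gt_eqF.
pose a1 := x1 / mu; pose a2 := x2 / mu.
have a10 : 0 < a1 by rewrite divr_gt0.
have a12 : a1 < a2 by rewrite ltr_pM2r// invr_gt0.
have a2n : a2 < n.+1%:R by rewrite ltr_pdivrMr.
pose f := @scaled_delay R n.
pose d := scaled_delay1 n a1.
(* The tangent parabola at [a1] has one free coefficient, fixed by passing through [f a2]. *)
pose k := (f a2 - f a1 - d * (a2 - a1)) / (a2 - a1) ^+ 2.
have kE : k * (a2 - a1) ^+ 2 = f a2 - f a1 - d * (a2 - a1).
  by rewrite divfK// expf_neq0// subr_eq0 gt_eqF.
clearbody k.
pose p : {poly R} := (f a1)%:P + d *: ('X - a1%:P) + k *: ('X - a1%:P) ^+ 2.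
have pE t : p.[t] = f a1 + d * (t - a1) + k * (t - a1) ^+ 2.
  by rewrite /p !hornerE.
have p1E t : (deriv p).[t] = d + 2 * k * (t - a1).
  by rewrite /p !poly.derivE !hornerE /=; ring.
have p2E t : (deriv (deriv p)).[t] = 2 * k.
  by rewrite /p !poly.derivE !hornerE /=; ring.
have p3E t : (deriv (deriv (deriv p))).[t] = 0.
  by rewrite /p !poly.derivE !hornerE /=; ring.
have pa2 : p.[a2] = f a2.
  by rewrite pE kE; ring.
have f_le_p t : 0 < t -> t <= a2 -> f t <= p.[t].
  move=> t0 ta2; rewrite -subr_le0.
  have dF (F F1 : R -> R) (q : {poly R}) :
      (forall t : R, 0 < t < n.+1%:R -> is_derive t 1 F (F1 t)) ->
      forall t : R, 0 < t < n.+1%:R ->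
      is_derive t 1 (F \- horner q) ((F1 \- horner (deriv q)) t).
    by move=> FF1 u uI; have FF1u := FF1 u uI; apply: is_deriveB.
  apply: (le_hermite_quadratic
    (dF _ _ p (@is_derive_scaled_delay R n))
    (dF _ _ (deriv p) (@is_derive_scaled_delay1 R n))
    (dF _ _ (deriv (deriv p)) (@is_derive_scaled_delay2 R n)) _ a10 a12 a2n) => //=.
  - by move=> u uI; rewrite p3E subr0 scaled_delay3_ge0.
  - by rewrite pE subrr mulr0 expr0n mulr0 !addr0 subrr.
  - by rewrite p1E subrr mulr0 addr0 subrr.
  - by rewrite pa2 subrr.
(* At arrival rate 0 the waiting time is [mu^-1], so the majorant needs exactly this; it follows
   from p >= f >= 0 on the right of 0 by passing to the limit. *)
have p0 : 0 <= p.[0].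
  have p_right0 : (horner p) t @[t --> 0^'+] --> p.[0].
    by apply: cvg_at_right_filter; exact: continuous_horner.
  rewrite -(cvg_lim _ p_right0)//; apply: limr_ge; first exact: cvgP p_right0.
  near=> t.
  have t0 : 0 < t by near: t; exact: nbhs_right_gt.
  have ta2 : t <= a2 by near: t; apply: nbhs_right_le; exact: lt_trans a12.
  apply: le_trans (f_le_p _ t0 ta2).
  by rewrite scaled_delay_ge0// t0 (le_lt_trans ta2).
(* The coefficients of [mu^-1 * (1 + p.[x / mu])] in powers of [x]. *)
exists (mu^-1 * (1 + (f a1 - d * a1 + k * a1 ^+ 2))),
  (mu^-1 * ((d - 2 * k * a1) / mu)), (mu^-1 * (k / mu ^+ 2)) => q.
have qE x : q x = mu^-1 * (1 + p.[x / mu]) by rewrite /q pE; field.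
have WE x : 0 < x -> x <= x2 ->
    waiting_time n.+1 mu x = mu^-1 * (1 + f (x / mu)).
  by move=> x0 xx2; rewrite waiting_time_scaled_delay// x0 (le_lt_trans xx2).
split => [x /andP[]| |].
- rewrite le_eqVlt qE => /predU1P[<- _|x0 xx2].
    by rewrite /waiting_time eqxx mul0r ler_peMr ?invr_ge0 ?(ltW mu0)// lerDl.
  rewrite WE// ler_pM2l ?invr_gt0// lerD2l f_le_p ?divr_gt0//.
  by rewrite ler_pM2r ?invr_gt0.
- by rewrite WE ?ltW// qE pE -/a1 subrr mulr0 expr0n mulr0 !addr0.
- by rewrite WE ?(lt_trans x10)// qE -/a2 pa2.
Unshelve. all: by end_near. Qed.

End Waiting.

(** * Expectations *)

Section Measurability.
Context {R : realType}.

Lemma measurable_funV d (T : measurableType d) (D : set T) (f : T -> R) :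
  measurable_fun D f -> measurable_fun D (fun x => (f x)^-1).
Proof.
move=> mf.
(* also at the zeros of [f], where [0^-1 = 0] *)
have -> : (fun x => (f x)^-1) = (fun x => f x * (f x ^+ 2) `^ (- 1)).
  apply/funext => x; have [->|fx0] := eqVneq (f x) 0; first by rewrite invr0 mul0r.
  by rewrite powR_inv1 ?sqr_ge0//; field.
apply: measurable_funM => //.
apply: (measurableT_comp (measurable_powR (- 1))).
exact: measurable_funX.
Qed.

Lemma measurable_erlang_C s (mu : R) :
  measurable_fun setT (erlang_C s mu : measurableTypeR R -> measurableTypeR R).
Proof.
have mid : measurable_fun setT (fun x : R => x / mu).
  by apply: measurable_funM => //.
have mtail : measurable_fun setT (erlang_tail s mu : R -> R).
  apply: measurable_funM; first by apply: measurable_funM => //; exact: measurable_funX.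
  apply: measurable_funV; apply: measurable_funB => //.
  exact: measurable_funM.
apply: measurable_funM => //; apply: measurable_funV; apply: measurable_funD => //.
apply: measurable_sum => k; apply: measurable_funM => //; exact: measurable_funX.
Qed.

Lemma measurable_waiting_time s (mu : R) : measurable_fun setT (waiting_time s mu).
Proof.
apply: measurable_fun_ifT => //.
  exact: measurable_fun_eqr.
apply: measurable_funM; last by apply: measurable_funV.
have mr : measurable_fun setT (utilization s mu : R -> R) by exact: measurable_funM.
apply: measurable_funD; first exact: measurable_funM.
apply: measurable_funM; last exact: measurable_erlang_C.
by apply: measurable_funM => //; apply: measurable_funV; apply: measurable_funB.
Qed.

End Measurability.

Section Expectation.
Context {R : realType}.
Implicit Types (P : probability (measurableTypeR R) R).

(** Off [D], a null set, the functions may have any sign. Passing to absolute values changes no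
    expectation and makes both nonnegative on the whole line. *)
Lemma ae_expectation_le P (D : set R) (X Y : R -> R) :
  measurable (D : set (measurableTypeR R)) -> P D = 1%E ->
  measurable_fun setT (X : measurableTypeR R -> R) ->
  measurable_fun setT (Y : measurableTypeR R -> R) ->
  (forall x, D x -> 0 <= X x <= Y x) -> ('E_P[X] <= 'E_P[Y])%E.
Proof.
move=> mD PD mX mY XY.
have mDC : measurable (~` D : set (measurableTypeR R)) by exact: measurableC.
have PDC : P (~` D) = 0%E by rewrite probability_setC// PD subee.
have ae_normr Z : measurable_fun setT (Z : measurableTypeR R -> R) ->
    (forall x, D x -> 0 <= Z x) -> ('E_P[Z] = 'E_P[fun x => `|Z x|%R])%E.
  move=> mZ Z0; rewrite unlock; apply: ae_eq_integral => //.
  - exact/measurable_EFinP.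
  - by apply/measurable_EFinP; exact: measurableT_comp.
  - exists (~` D); split => //.
    move=> x /= h Dx; apply: h => _.
    by rewrite ger0_norm ?Z0.
rewrite (ae_normr X)//; last by move=> x /XY /andP[].
rewrite (ae_normr Y)//; last by move=> x /XY /andP[]; exact: le_trans.
apply: expectation_le => //; try by exact: measurableT_comp.
exists (~` D); split => //; move=> x /= h Dx; apply: h; have /andP[X0 XYx] := XY x Dx.
by rewrite !ger0_norm// (le_trans X0).
Qed.

Lemma ae_expectation_eq P (D : set R) (X Y : R -> R) :
  measurable (D : set (measurableTypeR R)) -> P D = 1%E ->
  measurable_fun setT (X : measurableTypeR R -> R) ->
  measurable_fun setT (Y : measurableTypeR R -> R) ->
  (forall x, D x -> 0 <= X x /\ X x = Y x) -> ('E_P[X] = 'E_P[Y])%E.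
Proof.
move=> mD PD mX mY XY; apply/eqP; rewrite eq_le; apply/andP; split.
  by apply: (ae_expectation_le mD) => // x /XY[X0 <-]; rewrite X0 lexx.
by apply: (ae_expectation_le mD) => // x /XY[X0 <-]; rewrite X0 lexx.
Qed.

Lemma expectation_quadratic P (m v c0 c1 c2 : R) :
  ('E_P[fun x : R => x] = m%:E)%E ->
  ('E_P[fun x : R => (x ^+ 2)%R] = v%:E)%E ->
  ('E_P[fun x : R => (c0 + c1 * x + c2 * x ^+ 2)%R] =
    (c0 + c1 * m + c2 * v)%:E)%E.
Proof.
move=> Em Ev.
have mX2 : measurable_fun setT (fun x : measurableTypeR R => (x ^+ 2 : R)).
  exact: measurable_funX.
have iX2 : P.-integrable setT (fun x : R => (x ^+ 2)%:E).
  apply/integrableP; split; first exact/measurable_EFinP.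
  under eq_integral do rewrite gee0_abs ?lee_fin ?sqr_ge0//.
  by move: Ev; rewrite unlock => ->; rewrite ltry.
have i1 : P.-integrable setT (EFin \o cst (1 : R)).
  exact: finite_measure_integrable_cst.
have iX : P.-integrable setT (fun x : R => x%:E).
  apply: (le_integrable measurableT _ _ (integrableD measurableT i1 iX2)).
    exact/measurable_EFinP.
  (* The finite second moment yields a first one through |x| <= 1 + x^2. *)
  move=> x _ /=; rewrite lee_fin [leRHS]ger0_norm; last by rewrite addr_ge0// sqr_ge0.
  have := sqr_ge0 (`|x| - 1); rewrite sqrrB1 real_normK ?num_real// -mulr_natr.
  have := normr_ge0 x; lra.
have L f : P.-integrable setT (EFin \o f) -> (f : R -> R) \in Lfun P 1.
  by move=> ?; exact/Lfun1_integrable.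
have -> : (fun x : R => c0 + c1 * x + c2 * x ^+ 2) =
  (cst c0 \+ (c1 \o* (fun x : R => x))) \+ (c2 \o* (fun x : R => x ^+ 2)).
  by apply/funext => x /=; rewrite [x * _]mulrC [x ^+ 2 * _]mulrC.
have LZ (c : R) (f : R -> R) : f \in Lfun P 1 -> c \o* f \in Lfun P 1.
  by move=> /(Lfun_scale c (lexx 1)).
have LX := L _ iX; have LX2 := L _ iX2; have L1 := Lfun_cst P c0 1.
rewrite !expectationD ?expectationZl ?expectation_cst ?Em ?Ev//.
- exact: LZ.
- apply: L; exact: (integrableD measurableT ((Lfun1_integrable _ _).1 L1)
    ((Lfun1_integrable _ _).1 (LZ c1 _ LX))).
- exact: LZ.
Qed.

End Expectation.

(** * Two-point laws and their moments *)

Section TwoPoint.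
Context {R : realType}.

(** The normalization of the weights is an argument, so that the probability instance below has its
    proof at hand. *)
Definition two_point_measure (x1 x2 : R) (p1 p2 : {nonneg R})
    of p1%:num + p2%:num = 1 : set (measurableTypeR R) -> \bar R :=
  measure_add (mscale p1 (dirac (x1 : measurableTypeR R)))
              (mscale p2 (dirac (x2 : measurableTypeR R))).

Section instance.
Variables (x1 x2 : R) (p1 p2 : {nonneg R}) (p12 : p1%:num + p2%:num = 1).
HB.instance Definition _ := Measure.on (two_point_measure x1 x2 p12).

Let two_point_measure_setT : two_point_measure x1 x2 p12 setT = 1%E.
Proof.
by rewrite /two_point_measure measure_addE /= /mscale /= !diracE !in_setT !mule1 -EFinD p12.
Qed.

HB.instance Definition _ := Measure_isProbability.Build _ _ _
  (two_point_measure x1 x2 p12) two_point_measure_setT.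
End instance.

Lemma two_point_measureP (x1 x2 p1 p2 : R) :
  0 <= p1 -> 0 <= p2 -> p1 + p2 = 1 ->
  exists P : probability (measurableTypeR R) R, is_two_point P x1 x2 p1 p2.
Proof.
move=> p10 p20 p12.
have p12' : (NngNum p10)%:num + (NngNum p20)%:num = 1 by [].
exists (two_point_measure x1 x2 p12') => A mA.
by rewrite /= /two_point_measure measure_addE.
Qed.

Lemma expectation_two_point (P : probability (measurableTypeR R) R)
    (x1 x2 p1 p2 : R) (f : R -> R) :
  0 <= p1 -> 0 <= p2 -> is_two_point P x1 x2 p1 p2 ->
  measurable_fun setT (f : measurableTypeR R -> R) -> (forall x, 0 <= f x) ->
  ('E_P[f] = (p1 * f x1 + p2 * f x2)%:E)%E.
Proof.
move=> p10 p20 P12 mf f0; rewrite unlock.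
have mf' : measurable_fun setT (EFin \o f : measurableTypeR R -> \bar R).
  exact/measurable_EFinP.
have f0' x : (setT x -> 0 <= (EFin \o f) x)%E by rewrite lee_fin.
pose M := measure_add
    (mscale (NngNum p10) (dirac (x1 : measurableTypeR R)))
    (mscale (NngNum p20) (dirac (x2 : measurableTypeR R))).
have PM (A : set (measurableTypeR R)) : measurable A -> P A = M A.
  by move=> /P12 ->; rewrite /M measure_addE.
rewrite (eq_measure_integral M); last first.
  move=> A mA _; exact: PM.
rewrite /M.
rewrite ge0_integral_measure_add// !ge0_integral_mscale// !integral_dirac//.
by rewrite !diracT !mul1e.
Qed.
End TwoPoint.

Lemma two_point_eq1 (R : realType) (P : probability (measurableTypeR R) R)
    (x1 x2 p1 p2 : R) (A : set R) : is_two_point P x1 x2 p1 p2 ->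
  p1 + p2 = 1 -> measurable (A : set (measurableTypeR R)) -> A x1 -> A x2 ->
  P A = 1%E.
Proof.
move=> P12 p12 mA Ax1 Ax2.
by rewrite P12// !diracE !mem_set// !mule1 -EFinD p12.
Qed.

Lemma two_point_ambiguity_set (R : realType)
    (P : probability (measurableTypeR R) R) (lmin lmax m sigma : R) :
  0 <= lmin -> lmin < m < lmax -> sigma ^+ 2 <= (lmax - m) * (m - lmin) ->
  is_two_point P (m - sigma ^+ 2 / (lmax - m)) lmax
      ((lmax - m) ^+ 2 / ((lmax - m) ^+ 2 + sigma ^+ 2))
      (sigma ^+ 2 / ((lmax - m) ^+ 2 + sigma ^+ 2)) ->
  ambiguity_set m sigma lmin lmax P.
Proof.
move=> l0 /andP[lm mu] v P12.
have d0 : 0 < lmax - m by rewrite subr_gt0.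
have dn0 : lmax - m != 0 by rewrite gt_eqF.
have s0 : 0 < (lmax - m) ^+ 2 + sigma ^+ 2.
  by rewrite ltr_pwDl ?exprn_gt0 ?sqr_ge0.
have sn0 : (lmax - m) ^+ 2 + sigma ^+ 2 != 0 by rewrite gt_eqF.
have p10 : 0 <= (lmax - m) ^+ 2 / ((lmax - m) ^+ 2 + sigma ^+ 2).
  by rewrite divr_ge0 ?sqr_ge0 ?ltW.
have p20 : 0 <= sigma ^+ 2 / ((lmax - m) ^+ 2 + sigma ^+ 2).
  by rewrite divr_ge0 ?sqr_ge0 ?ltW.
have p12 : (lmax - m) ^+ 2 / ((lmax - m) ^+ 2 + sigma ^+ 2) +
    sigma ^+ 2 / ((lmax - m) ^+ 2 + sigma ^+ 2) = 1 by rewrite -mulrDl divff.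
(* The variance bound says precisely that the lower atom is not below [lmin]. *)
have x1l : lmin <= m - sigma ^+ 2 / (lmax - m).
  by rewrite lerBrDr -lerBrDl ler_pdivrMr// mulrC.
have x1m : m - sigma ^+ 2 / (lmax - m) <= m.
  by rewrite gerBl divr_ge0 ?sqr_ge0 ?ltW.
have PD : P `[lmin, lmax]%classic = 1%E.
  apply: (two_point_eq1 P12) => //=; rewrite in_itv /= ?lexx ?andbT.
    by rewrite x1l (le_trans x1m) ?ltW.
  by rewrite ltW// (lt_trans lm).
split => //.
(* [expectation_two_point] asks for a function nonnegative everywhere, so the identity is traded for
   the absolute value, equal to it on the support. *)
- rewrite (@ae_expectation_eq _ P `[lmin, lmax] _ (fun x => `|x|))//; last first.
    by move=> x /=; rewrite in_itv /= => /andP[/(le_trans l0) x0 _]; rewrite ger0_norm.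
    exact: normr_measurable.
  rewrite (expectation_two_point p10 p20 P12); first 1 last.
  + exact: normr_measurable.
  + by [].
  rewrite !ger0_norm.
  + by congr (_%:E); field; rewrite sn0 dn0.
  + by rewrite (le_trans l0)// ltW// (lt_trans lm).
  + exact: le_trans x1l.
- rewrite (expectation_two_point p10 p20 P12)//; last by move=> x; exact: sqr_ge0.
  by congr (_%:E); field; rewrite sn0 dn0.
Qed.

(** * Optimality certified by the quadratic majorant *)

Theorem theorem1 (R : realType) (s : nat) (mu lmin lmax m sigma : R)
    (hs : (1 <= s)%N) (hmu : 0 < mu)
    (hlmin : 0 <= lmin) (hl : lmin < lmax) (hlmax : lmax < s%:R * mu)
    (hm : lmin < m < lmax) (hsigma : 0 < sigma)
    (hsigma2 : 0 < sigma ^+ 2 < (lmax - m) * (m - lmin)) :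
  exists Pstar : probability (measurableTypeR R) R,
    is_two_point Pstar
      (m - sigma ^+ 2 / (lmax - m)) lmax
      ((lmax - m) ^+ 2 / ((lmax - m) ^+ 2 + sigma ^+ 2))
      (sigma ^+ 2 / ((lmax - m) ^+ 2 + sigma ^+ 2)) /\
    attains_max (ambiguity_set m sigma lmin lmax) (waiting_time s mu) Pstar.
Proof.
have /andP[lm mlmax] := hm; have /andP[s20 s2] := hsigma2.
have d0 : 0 < lmax - m by rewrite subr_gt0.
set x1 := m - _; set p1 := _ ^+ 2 / _; set p2 := sigma ^+ 2 / (_ + _).
have s0 : 0 < (lmax - m) ^+ 2 + sigma ^+ 2 by rewrite addr_gt0 ?exprn_gt0.
have p10 : 0 <= p1 by rewrite divr_ge0 ?sqr_ge0 ?ltW.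
have p20 : 0 <= p2 by rewrite divr_ge0 ?sqr_ge0 ?ltW.
have p12 : p1 + p2 = 1 by rewrite -mulrDl divff ?gt_eqF.
(* The strict variance bound gives [0 < x1] even when [lmin = 0], as tangency at [x1] requires. *)
have x1l : lmin < x1 by rewrite ltrBrDr -ltrBrDl ltr_pdivrMr// mulrC.
have x1u : x1 < lmax by rewrite (lt_trans _ mlmax)// gtrBl divr_gt0.
have x10 : 0 < x1 := le_lt_trans hlmin x1l.
have [P P12] := two_point_measureP x1 lmax p10 p20 p12.
exists P; split => //.
have PA : ambiguity_set m sigma lmin lmax P.
  by apply: two_point_ambiguity_set P12 => //; exact: ltW.
split => // Q [QD QE QE2].
have [PD PE PE2] := PA.
have [c0 [c1 [c2 /= [Wq Wx1 Wx2]]]] :=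
  waiting_time_le_quadratic hs hmu x10 x1u hlmax.
have W0 x : 0 <= x <= lmax -> 0 <= waiting_time s mu x.
  by move=> /andP[x0 xl]; rewrite waiting_time_ge0// x0 (le_lt_trans xl).
have mq : measurable_fun setT
    ((fun x => c0 + c1 * x + c2 * x ^+ 2) : measurableTypeR R -> R).
  apply: measurable_funD; first by apply: measurable_funD => //; exact: measurable_funM.
  exact: measurable_funM.
have mW := measurable_waiting_time s mu.
(* The majorant touches the waiting time at both atoms, which carry all the mass of [P]. *)
have -> : ('E_P[waiting_time s mu] =
    'E_P[fun x : R => (c0 + c1 * x + c2 * x ^+ 2)%R])%E.
  apply: (@ae_expectation_eq _ P [set x1; lmax]) => //.
  - by apply: measurableU; exact: measurable_set1.
  - apply: (two_point_eq1 P12) => //; [|by left|by right].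
    by apply: measurableU; exact: measurable_set1.
  - move=> x [->|->]; split => //; apply: W0.
      by rewrite !ltW.
    by rewrite lexx ltW// (lt_trans x10).
(* [P] and [Q] share two moments, so the quadratic has the same mean under both; what remains is the
   majorization under [Q]. *)
rewrite (expectation_quadratic _ _ _ PE PE2) -(expectation_quadratic _ _ _ QE QE2).
apply: (@ae_expectation_le _ Q `[lmin, lmax]) => // x /=.
rewrite in_itv /= => /andP[lx xl].
by have x0 := le_trans hlmin lx; rewrite Wq ?W0 ?x0.
Qed.
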